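(* Let $H\subseteq G$ be a subgroup with $\Gamma(1)\subseteq H\subseteq K$, let $H_\kappa$ be the image of $H$ in $G_\kappa=K/\Gamma(1)$, and let $\pi$ be a finite-dimensional representation of $H_\kappa$, also viewed as a representation of $\widetilde{\mathsf H}$ by inflation along $\widetilde{\mathsf H}\twoheadrightarrow H_\kappa$. Then there is a $\mathbb{C}$-algebra isomorphism \[ \mathcal{H}(G_\kappa,H_\kappa;\pi)\cong\mathcal{H}(\widetilde{\mathsf K},\widetilde{\mathsf H};\pi\otimes\sigma) \] which restricts, for every $x\in G_\kappa$, to an isomorphism of $\mathbb{C}$-vector spaces \[ \mathcal{H}(G_\kappa,H_\kappa;\pi)_x\cong\mathcal{H}(\widetilde{\mathsf K},\widetilde{\mathsf H};\pi\otimes\sigma)_{\tilde x}, \] where $\tilde x\in\widetilde{\mathsf K}$ is any preimage of $x$ under $\widetilde{\mathsf K}\twoheadrightarrow G_\kappa$ (the right-hand side is independent of the choice of $\tilde x$).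
   Context: $F$ is a finite extension of $\mathbb{Q}_2$ with ring of integers $\mathcal{O}$, uniformizer $\varpi$, residue field $\kappa=\mathcal{O}/\varpi\mathcal{O}$, ramification index $e$ ($2\mathcal{O}=\varpi^e\mathcal{O}$). $(-,-)$ is the quadratic Hilbert symbol of $F$. $G$ is the group of $F$-points of an almost simple simply-connected split (Chevalley) group with irreducible simply-laced root system $\Phi$ (relative to a split maximal torus $T$) of rank at least $2$; $G_\kappa$ is the group of $\kappa$-points of the Chevalley group of the same type. $\Delta=\{\alpha_1,\dots,\alpha_r\}$ is a set of simple roots, $\Phi^\pm$ the positive/negative roots. $x_\alpha(t)$ are the Chevalley generators, $w_\alpha(t)=x_\alpha(t)x_{-\alpha}(-t^{-1})x_\alpha(t)$, $h_\alpha(t)=w_\alpha(t)w_\alpha(-1)$. $\widetilde{G}$ is the unique nontrivial topological central extension $1\to\mu_2\to\widetilde{G}\xrightarrow{\mathrm{pr}}G\to1$; it is generated by $\mu_2$ and lifts $\tilde{x}_\alpha(t)$ of $x_\alpha(t)$ with relations $\tilde x_\alpha(t)\tilde x_\alpha(u)=\tilde x_\alpha(t+u)$; for $\alpha+\beta\ne0$, $[\tilde x_\alpha(t),\tilde x_\beta(u)]=\tilde x_{\alpha+\beta}(ctu)$ if $\alpha+\beta\in\Phi$ (with $c=c(\alpha,\beta)\in\{\pm1\}$ as in $G$) and $1$ otherwise; $\tilde h_\alpha(t)\tilde h_\alpha(u)=(t,u)\tilde h_\alpha(tu)$, where $\tilde w_\alpha(t)=\tilde x_\alpha(t)\tilde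 x_{-\alpha}(-t^{-1})\tilde x_\alpha(t)$, $\tilde h_\alpha(t)=\tilde w_\alpha(t)\tilde w_\alpha(-1)$. For $H\subseteq G$, $\widetilde{H}=\mathrm{pr}^{-1}(H)$. A representation is genuine if $-1\in\mu_2$ acts by $-1$. Subgroups: $T_0=\langle h_\alpha(u):u\in\mathcal{O}^\times,\alpha\in\Phi\rangle$; $T_k=\langle h_\alpha(u):u\in1+\varpi^k\mathcal{O},\alpha\in\Phi\rangle$ for $k\ge1$; $U_j^\pm=\langle x_\alpha(t):\alpha\in\Phi^\pm,t\in\varpi^j\mathcal{O}\rangle$, $U_j=U_j^+$, viewed in $\widetilde G$ via $x_\alpha(t)\mapsto\tilde x_\alpha(t)$; $K=\langle x_\alpha(t):\alpha\in\Phi,t\in\mathcal{O}\rangle$; $\Gamma(k)=\langle T_k,\,x_\alpha(t):\alpha\in\Phi,t\in\varpi^k\mathcal{O}\rangle$. Splitting of $\Gamma(2e)$: each element of $\Gamma(2e)$ is uniquely $u^-tu^+$ with $u^\pm\in U^\pm_{2e}$, $t=\prod_i h_{\alpha_i}(a_i)\in T_{2e}$; the map $\mathbf{s}$ lifting $u^\pm$ by $x_\alpha(\cdot)\mapsto\tilde x_\alpha(\cdot)$ and $t$ to $\prod_i\tilde h_{\alpha_i}(a_i)$ is a homomorphism $\Gamma(2e)\to\widetilde G$ with image normal in $\widetilde{K}$. Put $\widetilde{\mathsf{K}}=\widetilde K/\mathbf{s}(\Gamma(2e))$; for $H\subseteq K$, $\widetilde{\mathsf H}$ denotes the image of $\widetilde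 H$ in $\widetilde{\mathsf K}$ (similarly for other sans-serif letters). $G_\kappa\cong K/\Gamma(1)\cong\widetilde{\mathsf K}/\widetilde{\mathsf\Gamma}(1)$. $R=\{a\in\mathcal{O}^\times:(a,b)=1\ \forall b\in\mathcal{O}^\times\}$, $T_R=\langle h_\alpha(a):a\in R,\alpha\in\Phi\rangle$, regarded as a subgroup of $\widetilde{T}_0$ via $\prod_i h_{\alpha_i}(a_i)\mapsto\prod_i\tilde h_{\alpha_i}(a_i)$. $\tau$ is a pseudo-spherical representation of $\widetilde{T}_0$, i.e. an irreducible genuine representation trivial on $T_R$; it factors through $\widetilde{\mathsf{T}}_0$ (as $T_{2e}\subseteq T_R$) and stays irreducible on $\widetilde{\mathsf T}_1$. Parahoric induction: if $A$ is a finite group with subgroups $P,L,Q$ such that $L$ normalizes $P$ and $Q$ and multiplication $P\times L\times Q\to A$ is bijective, then $i_{P,Q}^A\tau=\mathbb{C}[A]e_Pe_Q\otimes_{\mathbb{C}[L]}\tau$ for a representation $\tau$ of $L$, where $e_P=|P|^{-1}\sum_{p\in P}p$, etc. The irreducible representation $i^{\widetilde{\mathsf\Gamma}(1)}_{\mathsf{U}_1,\mathsf{U}_1^-}\tau$ of $\widetilde{\mathsf\Gamma}(1)$ extends uniquely to a representation of $\widetilde{\mathsf K}$, denoted $\sigma$; its restrictions to subgroups are also denoted $\sigma$. For a finite (or locally compact) group $A$, an (open compact) subgroup $J$ and a finite-dimensional representation $\lambda$ of $J$, $\mathcal{H}(A,J;\lambda)$ is the algebra under convolution $f_1*f_2(g)=\int_A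 f_1(h)f_2(h^{-1}g)\,dh$ (Haar measure giving $J$ volume $1$) of functions $f\in C_c^\infty(A,\mathrm{End}_{\mathbb{C}}(\lambda^\vee))$ with $f(k_1gk_2)=\lambda^\vee(k_1)f(g)\lambda^\vee(k_2)$, $k_1,k_2\in J$; $\mathcal{H}(A,J;\lambda)_g$ is the subspace of functions vanishing outside $JgJ$. *)

(* Defs.v *)
From HB Require Import structures.
From mathcomp Require Import all_boot all_order all_algebra all_fingroup all_field.
From mathcomp Require Import mxrepresentation character.
From mathcomp Require Import boolp classical_sets reals.
From mathcomp Require Import complex.

Set Implicit Arguments.
Unset Strict Implicit.
Unset Printing Implicit Defensive.

Import Order.TTheory GRing.Theory Num.Theory GroupScope.

Local Open Scope classical_set_scope.
Local Open Scope ring_scope.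

(* Q_2 as the completion of the rationals for the 2-adic absolute value. *)
Record is_Q2 (K : fieldType) (nm : K -> rat) : Prop := IsQ2 {
  Q2_nm_ge0 : forall x, 0 <= nm x;
  Q2_nm_eq0 : forall x, nm x = 0 <-> x = 0;
  Q2_nmM : forall x y, nm (x * y) = nm x * nm y;
  Q2_nmD : forall x y, nm (x + y) <= Num.max (nm x) (nm y);
  Q2_nm_nat : forall n : nat, (0 < n)%N -> nm n%:R = 2%:R ^- logn 2 n;
  Q2_dense : forall (x : K) (eps : rat), 0 < eps ->
    exists a : rat, nm (x - ratr a) < eps;
  Q2_complete : forall u : nat -> K,
    (forall eps : rat, 0 < eps -> exists N, forall i j,
       (N <= i)%N -> (N <= j)%N -> nm (u i - u j) < eps) ->
    exists l : K, forall eps : rat, 0 < eps -> exists N, forall i,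
       (N <= i)%N -> nm (u i - l) < eps }.

(* The integral closure in F of the valuation ring of K. *)
Definition integers (K : fieldType) (nm : K -> rat) (F : fieldExtType K) :
    set F :=
  [set z | exists p : {poly K}, [/\ p \is monic, forall i, nm p`_i <= 1
                                  & root (map_poly (in_alg F) p) z]].

Definition units_of (F : fieldType) (O : set F) : set F :=
  [set u | [/\ u != 0, O u & O u^-1]].

(* Besides the field, the structure records a uniformizer, the ramification
   index and the residue field; [res] is reduction modulo the uniformizer, and
   is meaningful on integers only. *)
Record dyadic_field := DyadicField {
  Q2 : fieldType;
  Q2_norm : Q2 -> rat;
  Q2P : is_Q2 Q2_norm;
  dfield :> fieldExtType Q2;
  OO : set dfield := @integers Q2 Q2_norm dfield;
  varpi : dfield;
  varpiP : forall z, (OO z /\ ~ units_of OO z) <->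
                     (exists2 y, OO y & z = varpi * y);
  ram : nat;
  ramP : exists2 u, units_of OO u & 2%:R = u * varpi ^+ ram;
  kappa : finFieldType;
  res : dfield -> kappa;
  res1 : res 1 = 1;
  resD : {in [pred z | `[< OO z >]] &, {morph res : y z / y + z}};
  resM : {in [pred z | `[< OO z >]] &, {morph res : y z / y * z}};
  res_surj : forall c, exists2 z, OO z & res z = c;
  res_eq0 : forall z, OO z -> (res z = 0 <-> exists2 y, OO y & z = varpi * y) }.

Section Field.
Variable D : dyadic_field.

Definition unitsO : set D := units_of (@OO D).
Definition ideal (k : nat) : set D :=
  [set z | exists2 y, OO y & z = varpi D ^+ k * y].
Definition punits (k : nat) : set D := [set u | ideal k (u - 1)].

(* [hilbert a b] means that the quadratic Hilbert symbol (a, b) is 1. *)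
Definition hilbert (a b : D) : Prop :=
  exists v : D * D * D, v <> (0, 0, 0) /\
    v.2 ^+ 2 = a * v.1.1 ^+ 2 + b * v.1.2 ^+ 2.

Definition Runits : set D :=
  [set a | unitsO a /\ forall b, unitsO b -> hilbert a b].

End Field.

Definition dot (R : realType) r (u v : 'rV[R]_r) : R := (u *m v^T) 0 0.

Definition cartan (R : realType) r (b a : 'rV[R]_r) : R :=
  2%:R * dot b a / dot a a.

Definition in_cone (R : realType) r (s : 'I_r -> 'rV[R]_r) (a : 'rV[R]_r) :=
  exists c : 'I_r -> nat, a = \sum_i (c i)%:R *: s i.

Record root_system (R : realType) := RootSystem {
  rank : nat;
  rank_ge2 : (2 <= rank)%N;
  roots : seq 'rV[R]_rank;
  roots_neq0 : 0 \notin roots;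
  roots_span : <<roots>>%VS = fullv;
  roots_refl : {in roots &, forall a b, b - cartan b a *: a \in roots};
  roots_int : {in roots &, forall a b, cartan b a \is a Num.int};
  roots_reduced : {in roots, forall a (c : R),
    c *: a \in roots -> c = 1 \/ c = -1};
  roots_irreducible : forall P : pred 'rV[R]_rank,
    {in roots &, forall a b, P a -> ~~ P b -> dot a b = 0} ->
    {in roots, forall a, P a} \/ {in roots, forall a, ~~ P a};
  roots_simply_laced : {in roots &, forall a b, dot a a = dot b b};
  simple : 'I_rank -> 'rV[R]_rank;
  simple_root : forall i, simple i \in roots;
  simple_base : {in roots, forall a, in_cone simple a \/ in_cone simple (- a)} }.

Definition pos_root (R : realType) (Phi : root_system R) : set ('rV[R]_(rank Phi)) :=
  [set a | a \in roots Phi /\ in_cone (@simple R Phi) a].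
Definition neg_root (R : realType) (Phi : root_system R) : set ('rV[R]_(rank Phi)) :=
  [set a | a \in roots Phi /\ in_cone (@simple R Phi) (- a)].

Definition is_subgroup (G : groupType) (H : set G) : Prop :=
  H 1%g /\ forall a b, H a -> H b -> H (a * b^-1)%g.

Definition gen (G : groupType) (S : set G) : set G := smallest (@is_subgroup G) S.

(* [q] presents the finite group [Q] as the quotient of the subgroup [D] of
   [G] by [N]; its values outside [D] are irrelevant. *)
Definition is_quotient (G : groupType) (D N : set G) (Q : finGroupType)
    (q : G -> Q) : Prop :=
  [/\ forall a b, D a -> D b -> q (a * b)%g = (q a * q b)%g,
      forall y, exists2 a, D a & q a = y,
      N `<=` D
    & forall a, D a -> (q a = 1%g <-> N a)].

(* The image of a set of elements of [G]; when it is a subgroup, as is always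
   the case below, the brackets do not enlarge it. *)
Definition img (G : groupType) (Q : finGroupType) (q : G -> Q) (S : set G) :
    {group Q} :=
  <<finset (fun y => `[< exists2 a, S a & q a = y >])>>%G.

(* A finite-dimensional representation of the simple Lie algebra of type Phi,
   with a lattice stable under the divided powers of a Chevalley basis:
   [dpow a j] is the matrix of X_a^j / j! on a basis of that lattice.  The
   group constructed from it is simply connected when the weights span the
   weight lattice, a weight being given by its values at the simple coroots. *)
Section Admissible.
Variables (R : realType) (Phi : root_system R) (n : nat).
Variable dpow : 'rV[R]_(rank Phi) -> nat -> 'M[int]_n.

Definition rootmx (a : 'rV[R]_(rank Phi)) : 'M[int]_n := dpow a 1%N.
Definition lie (A B : 'M[int]_n) : 'M[int]_n := A *m B - B *m A.
Definition corootmx (a : 'rV[R]_(rank Phi)) : 'M[int]_n := lie (rootmx a) (rootmx (- a)).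

Definition is_weight (mu : 'rV[int]_(rank Phi)) : Prop :=
  exists2 v : 'cV[int]_n, v != 0 &
    forall i, corootmx (simple i) *m v = mu 0 i *: v.

End Admissible.

Record admissible_repr (R : realType) (Phi : root_system R) := AdmissibleRepr {
  adim : nat;
  dpow : 'rV[R]_(rank Phi) -> nat -> 'M[int]_adim;
  strc : 'rV[R]_(rank Phi) -> 'rV[R]_(rank Phi) -> int;
  dpowE : {in roots Phi, forall a j,
    dpow a j *+ j`! = rootmx dpow a ^+ j};
  strc_sign : {in roots Phi &, forall a b, a + b \in roots Phi ->
    strc a b = 1 \/ strc a b = -1};
  lie_root : {in roots Phi &, forall a b, a + b \in roots Phi ->
    lie (rootmx dpow a) (rootmx dpow b) = strc a b *: rootmx dpow (a + b)};
  lie_root0 : {in roots Phi &, forall a b, a + b != 0 ->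
    a + b \notin roots Phi -> lie (rootmx dpow a) (rootmx dpow b) = 0};
  lie_coroot : {in roots Phi &, forall a b, forall z : int,
    z%:~R = cartan b a ->
    lie (corootmx dpow a) (rootmx dpow b) = z *: rootmx dpow b};
  weights_span : forall lam : 'rV[int]_(rank Phi),
    exists2 s : seq (int * 'rV[int]_(rank Phi)),
      forall t, t \in s -> is_weight dpow t.2
      & lam = \sum_(t <- s) t.1 *: t.2 }.

Section Chevalley.
Variables (R : realType) (Phi : root_system R).

(* exp (t X_a); the sum stops because X_a is a nilpotent matrix of size
   [adim A]. *)
Definition expmx (A : admissible_repr Phi) (k : fieldType) (a : 'rV[R]_(rank Phi)) (t : k) :
    'M[k]_(adim A) :=
  \sum_(j < (adim A).+1) t ^+ j *: map_mx intr (dpow A a j).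

Definition chevalley_group (A : admissible_repr Phi) (k : fieldType)
    (G : groupType) (x : 'rV[R]_(rank Phi) -> k -> G) : Prop :=
  (exists iota : G -> 'M[k]_(adim A),
     [/\ injective iota, iota 1%g = 1%:M,
         forall g h, iota (g * h)%g = iota g *m iota h
       & {in roots Phi, forall a t, iota (x a t) = expmx A a t}]) /\
  gen [set g | exists a t, a \in roots Phi /\ g = x a t] = setT.

Section Elements.
Variables (k : fieldType) (G : groupType) (x : 'rV[R]_(rank Phi) -> k -> G).

Definition wel (a : 'rV[R]_(rank Phi)) (t : k) : G := (x a t * x (- a) (- t^-1) * x a t)%g.
Definition hel (a : 'rV[R]_(rank Phi)) (t : k) : G := (wel a t * wel a (-1))%g.

(* [root_gen P S] is generated by the x_a(t) with a in P and t in S. *)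
Definition root_gen (P : set ('rV[R]_(rank Phi))) (S : set k) : set G :=
  gen [set g | exists a t, [/\ P a, S t & g = x a t]].
Definition torus_gen (S : set k) : set G :=
  gen [set g | exists a t, [/\ a \in roots Phi, S t & g = hel a t]].
Definition torus_prod (S : set k) : set G :=
  [set g | exists2 c : 'I_(rank Phi) -> k, forall i, S (c i)
                   & g = (\prod_i hel (simple i) (c i))%g].

End Elements.

Section Subgroups.
Variables (D : dyadic_field) (G : groupType) (x : 'rV[R]_(rank Phi) -> D -> G).

Definition Kgrp : set G := root_gen x [set a | a \in roots Phi] (@OO D).
Definition T0grp : set G := torus_gen x (@unitsO D).
Definition Tgrp (k : nat) : set G := torus_gen x (@punits D k).
Definition Upos (j : nat) : set G := root_gen x (@pos_root R Phi) (ideal j).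
Definition Uneg (j : nat) : set G := root_gen x (@neg_root R Phi) (ideal j).
Definition Gamma (k : nat) : set G :=
  gen (Tgrp k `|` root_gen x [set a | a \in roots Phi] (ideal k)).

(* Applied to the lifted generators of the double cover, this is the image of
   the splitting of Gamma(2e). *)
Definition split_Gamma2e : set G :=
  [set g | exists u t v, [/\ Uneg (2 * ram D)%N u,
                             torus_prod x (punits (2 * ram D)%N) t,
                             Upos (2 * ram D)%N v & g = (u * t * v)%g]].

Definition TRgrp : set G := torus_prod x (@Runits D).

End Subgroups.

(* [pr : Gt -> G] is a central extension with kernel mu_2 = {1, eps}; [xt a t]
   lifts [x a t]. *)
Record double_cover (A : admissible_repr Phi) (D : dyadic_field) (G Gt : groupType)
    (x : 'rV[R]_(rank Phi) -> D -> G) (pr : Gt -> G) (eps : Gt)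
    (xt : 'rV[R]_(rank Phi) -> D -> Gt) : Prop := DoubleCover {
  cov_morph : forall g h, pr (g * h)%g = (pr g * pr h)%g;
  cov_surj : forall g, exists h, pr h = g;
  cov_ker : forall g, pr g = 1%g <-> g = 1%g \/ g = eps;
  cov_eps : eps <> 1%g;
  cov_central : forall g, (eps * g = g * eps)%g;
  cov_gen : gen (eps |` [set g | exists a t, a \in roots Phi /\ g = xt a t])
            = setT;
  cov_lift : {in roots Phi, forall a t, pr (xt a t) = x a t};
  cov_add : {in roots Phi, forall a t u, xt a (t + u) = (xt a t * xt a u)%g};
  cov_comm : {in roots Phi &, forall a b t u, a + b \in roots Phi ->
    [~ xt a t, xt b u]%g = xt (a + b) ((strc A a b)%:~R * t * u)};
  cov_comm1 : {in roots Phi &, forall a b t u, a + b != 0 ->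
    a + b \notin roots Phi -> [~ xt a t, xt b u]%g = 1%g};
  cov_hilbert : {in roots Phi, forall a t u, t != 0 -> u != 0 ->
    (hel xt a t * hel xt a u =
     (if `[< hilbert t u >] then 1 else eps) * hel xt a (t * u))%g} }.

(* Reduction modulo the uniformizer identifies K / Gamma(1) with the group of
   points over the residue field. *)
Definition is_reduction (D : dyadic_field) (G : groupType) (Gk : finGroupType)
    (x : 'rV[R]_(rank Phi) -> D -> G) (xk : 'rV[R]_(rank Phi) -> kappa D -> Gk) (red : G -> Gk) : Prop :=
  is_quotient (Kgrp x) (Gamma x 1%N) red /\
  {in roots Phi, forall a t, OO t -> red (x a t) = xk a (res t)}.

End Chevalley.

Definition lspan (C : fieldType) (V : lmodType C) (S : set V) : set V :=
  [set w | exists2 s : seq (C * V), forall t, t \in s -> S t.2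
                                  & w = \sum_(t <- s) t.1 *: t.2].

(* Functions [gT -> C] represent the group algebra.  A tensor in
   C[gT] (x)_C C^m is represented by a function with values in column vectors. *)
Section Parahoric.
Variables (C : fieldType) (gT : finGroupType).

Definition ga_mul (y z : {ffun gT -> C}) : {ffun gT -> C} :=
  [ffun g => \sum_h y h * z (h^-1 * g)%g].
Definition ga_idem (P : {set gT}) : {ffun gT -> C} :=
  [ffun g => (g \in P)%:R / #|P|%:R].
Definition ga_elt (l : gT) : {ffun gT -> C} := [ffun g => (g == l)%:R].

Definition ga_PQ (A P Q : {set gT}) : set {ffun gT -> C} :=
  [set y | exists2 z : {ffun gT -> C}, forall g, g \notin A -> z g = 0
           & y = ga_mul (ga_mul z (ga_idem P)) (ga_idem Q)].

Definition tensor m (y : {ffun gT -> C}) (v : 'cV[C]_m) : {ffun gT -> 'cV[C]_m} :=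
  [ffun g => y g *: v].

(* [rho] is isomorphic to C[A] e_P e_Q (x)_C[L] tau, the latter being the
   quotient of the tensor product over C by the balancing relations for L;
   the isomorphism is induced by [B]. *)
Definition is_parahoric_ind (A P Q L : {group gT}) m (tau : gT -> 'M[C]_m) N
    (rho : mx_representation C A N) : Prop :=
  exists B : {linear {ffun gT -> 'cV[C]_m} -> 'cV[C]_N},
  let M := ga_PQ A P Q in
  let MT := lspan [set w | exists y v, M y /\ w = tensor y v] in
  let balanced := lspan [set w | exists y l v,
       [/\ M y, l \in L
         & w = tensor (ga_mul y (ga_elt l)) v - tensor y (tau l *m v)]] in
  [/\ forall z, exists2 w, MT w & B w = z,
      forall w, MT w -> (B w = 0 <-> balanced w)
    & forall g y v, g \in A -> M y ->
        B (tensor (ga_mul (ga_elt g) y) v) = rho g *m B (tensor y v)].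

End Parahoric.

(* [tau] is given on the image of the cover of T_0 in the finite quotient,
   through which it factors. *)
Definition pseudo_spherical (C : fieldType) (Gt : groupType) (Q : finGroupType)
    (q : Gt -> Q) (eps : Gt) (TR : set Gt) (T0 : {group Q}) m
    (tau : mx_representation C T0 m) : Prop :=
  [/\ mx_irreducible tau, tau (q eps) = (-1)%:M
    & forall t, TR t -> tau (q t) = 1%:M].

Section Tensor.
Variables (C : fieldType) (gT rT : finGroupType).
Variable p : {morphism [set: gT]%G >-> rT}.

Definition infl_tensor (J : {group gT}) (I : {group rT})
    (sJI : J \subset p @*^-1 I) d m (pi : mx_representation C I d)
    (sigma : mx_representation C [set: gT]%G m) : mx_representation C J (d * m) :=
  prod_repr (subg_repr (morphpre_repr p pi) sJI) (subg_repr sigma (finset.subsetT J)).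

Lemma infl_tensorE J I sJI d m pi sigma g :
  @infl_tensor J I sJI d m pi sigma g = tprod (pi (p g)) (sigma g).
Proof. by []. Qed.

End Tensor.

Lemma img_sub (G Gt : groupType) (Gk Kt : finGroupType) (pr : Gt -> G)
    (q : Gt -> Kt) (red : G -> Gk) (p : {morphism [set: Kt]%G >-> Gk})
    (K H : set G) :
  (forall g, K (pr g) -> p (q g) = red (pr g)) -> H `<=` K ->
  img q (pr @^-1` H) \subset p @*^-1 (img red H).
Proof.
move=> pq sHK; rewrite gen_subG; apply/fintype.subsetP => y.
rewrite inE => /asboolP[g Hg <-]; rewrite !inE /=.
rewrite pq; last exact: sHK.
by apply: mem_gen; rewrite inE; apply/asboolP; exists (pr g).
Qed.

Section Hecke.
Variables (C : numFieldType) (gT : finGroupType) (J : {group gT}) (d : nat).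
Variable lam : mx_representation C J d.

Definition dual_mx (k : gT) : 'M[C]_d := (lam k^-1%g)^T.

Definition hecke_pred : {pred {ffun gT -> 'M[C]_d}} :=
  [pred f : {ffun gT -> 'M[C]_d} |
   [forall k1 in J, forall k2 in J, forall g,
     f (k1 * g * k2)%g == dual_mx k1 *m f g *m dual_mx k2]].

Lemma heckeP (f : {ffun gT -> 'M[C]_d}) :
  reflect (forall k1 k2 g, k1 \in J -> k2 \in J ->
             f (k1 * g * k2)%g = dual_mx k1 *m f g *m dual_mx k2)
          (f \in hecke_pred).
Proof.
apply: (iffP forall_inP) => [h k1 k2 g J1 J2|h k1 J1].
  by have /forall_inP/(_ k2 J2)/forallP/(_ g)/eqP := h k1 J1.
by apply/forall_inP => k2 J2; apply/forallP => g; rewrite h.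
Qed.

Lemma hecke_submod : submod_closed hecke_pred.
Proof.
split=> [|a f1 f2 /heckeP h1 /heckeP h2].
  by apply/heckeP => k1 k2 g _ _; rewrite !ffunE mulmx0 mul0mx.
apply/heckeP => k1 k2 g J1 J2; rewrite !ffunE h1 // h2 //.
by rewrite mulmxDr mulmxDl -scalemxAr -scalemxAl.
Qed.

HB.instance Definition _ :=
  GRing.isSubmodClosed.Build C {ffun gT -> 'M[C]_d} hecke_pred hecke_submod.

Record hecke := Hecke { hecke_val :> {ffun gT -> 'M[C]_d};
                        hecke_valP : hecke_val \in hecke_pred }.

HB.instance Definition _ := [isSub for hecke_val].
HB.instance Definition _ := [Choice of hecke by <:].
HB.instance Definition _ := [SubChoice_isSubLmodule of hecke by <:].

Lemma dual1 : dual_mx 1%g = 1%:M.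
Proof. by rewrite /dual_mx invg1 repr_mx1 trmx1. Qed.

Lemma dualM : {in J &, {morph dual_mx : a b / (a * b)%g >-> a *m b}}.
Proof.
by move=> a b Ja Jb; rewrite /dual_mx invMg repr_mxM ?groupV // trmx_mul.
Qed.

(* The Haar measure giving J volume 1 puts mass 1/|J| at each point. *)
Definition conv (f1 f2 : {ffun gT -> 'M[C]_d}) : {ffun gT -> 'M[C]_d} :=
  [ffun g => #|J|%:R^-1 *: \sum_h f1 h *m f2 (h^-1 * g)%g].

Definition conv1 : {ffun gT -> 'M[C]_d} :=
  [ffun g => if g \in J then dual_mx g else 0].

Lemma conv_hecke (f1 f2 : hecke) : conv f1 f2 \in hecke_pred.
Proof.
apply/heckeP => k1 k2 g J1 J2; rewrite !ffunE -scalemxAr -scalemxAl.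
congr (_ *: _); rewrite mulmx_sumr mulmx_suml.
rewrite (reindex_inj (mulgI k1)) /=; apply: eq_bigr => h _.
have /heckeP h1 := hecke_valP f1; have /heckeP h2 := hecke_valP f2.
have -> : f1 (k1 * h)%g = dual_mx k1 *m f1 h.
  by rewrite -{1}[(k1 * h)%g]mulg1 h1 // dual1 mulmx1.
have -> : ((k1 * h)^-1 * (k1 * g * k2) = 1 * (h^-1 * g) * k2)%g.
  by rewrite invMg mul1g !mulgA mulgKV.
by rewrite h2 // dual1 mul1mx !mulmxA.
Qed.

Lemma conv1_hecke : conv1 \in hecke_pred.
Proof.
apply/heckeP => k1 k2 g J1 J2; rewrite !ffunE groupMr // groupMl //.
case: ifP => Jg; last by rewrite mulmx0 mul0mx.
by rewrite !dualM ?groupM.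
Qed.

Definition hmul (f1 f2 : hecke) : hecke := Hecke (conv_hecke f1 f2).
Definition hone : hecke := Hecke conv1_hecke.

Lemma cardJ_neq0 : (#|J|%:R : C) != 0.
Proof. by rewrite pnatr_eq0 -lt0n cardG_gt0. Qed.

Lemma hmulA : associative hmul.
Proof.
move=> f1 f2 f3; apply: val_inj; apply/ffunP => g /=; rewrite !ffunE.
congr (_ *: _).
under eq_bigr do rewrite ffunE -scalemxAr mulmx_sumr.
under [in RHS]eq_bigr do rewrite ffunE -scalemxAl mulmx_suml.
rewrite -!scaler_sumr; congr (_ *: _).
rewrite [in RHS]exchange_big /=; apply: eq_bigr => h _.
rewrite [RHS](reindex_inj (mulgI h)) /=; apply: eq_bigr => k _.
by rewrite mulKg mulmxA invMg mulgA.
Qed.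

Lemma hmul1l : left_id hone hmul.
Proof.
move=> f; apply: val_inj; apply/ffunP => g /=; rewrite !ffunE.
rewrite (bigID (mem J)) /= addrC big1 ?add0r => [|h /negbTE Jh]; last first.
  by rewrite ffunE Jh mul0mx.
rewrite (eq_bigr (fun=> f g)) => [|h Jh]; last first.
  rewrite ffunE Jh; have /heckeP hf := hecke_valP f.
  have := hf h 1%g (h^-1 * g)%g Jh (group1 J).
  by rewrite mulg1 mulKVg dual1 mulmx1 => ->.
by rewrite sumr_const -scaler_nat scalerA mulVf ?scale1r ?cardJ_neq0.
Qed.

Lemma hmul1r : right_id hone hmul.
Proof.
move=> f; apply: val_inj; apply/ffunP => g /=; rewrite !ffunE.
rewrite (reindex_inj (mulgI g)) (reindex_inj invg_inj) /=.
rewrite (bigID (mem J)) /= addrC big1 ?add0r => [|h /negbTE Jh]; last first.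
  by rewrite ffunE invMg invgK mulgKV Jh mulmx0.
rewrite (eq_bigr (fun=> f g)) => [|h Jh]; last first.
  rewrite ffunE invMg invgK mulgKV Jh; have /heckeP hf := hecke_valP f.
  have := hf 1%g h (g * h^-1)%g (group1 J) Jh.
  by rewrite mul1g mulgKV dual1 mul1mx => ->.
by rewrite sumr_const -scaler_nat scalerA mulVf ?scale1r ?cardJ_neq0.
Qed.

Lemma hmulDl : left_distributive hmul +%R.
Proof.
move=> f1 f2 f3; apply: val_inj; apply/ffunP => g /=; rewrite !ffunE.
rewrite -scalerDr -big_split /=; congr (_ *: _).
by apply: eq_bigr => h _; rewrite ffunE mulmxDl.
Qed.

Lemma hmulDr : right_distributive hmul +%R.
Proof.
move=> f1 f2 f3; apply: val_inj; apply/ffunP => g /=; rewrite !ffunE.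
rewrite -scalerDr -big_split /=; congr (_ *: _).
by apply: eq_bigr => h _; rewrite ffunE mulmxDr.
Qed.

HB.instance Definition _ :=
  GRing.Zmodule_isPzRing.Build hecke hmulA hmul1l hmul1r hmulDl hmulDr.

(* The library's algebras are nonzero rings, whereas the Hecke algebra of the
   zero representation is the zero ring; so it is only given its ring and
   module structures, which are compatible by the next two lemmas. *)
Lemma hecke_scaleAl (a : C) (f1 f2 : hecke) : a *: (f1 * f2) = (a *: f1) * f2.
Proof.
apply: val_inj; apply/ffunP => g /=; rewrite !ffunE scalerA mulrC -scalerA.
rewrite scaler_sumr; congr (_ *: _).
by apply: eq_bigr => h _; rewrite ffunE scalemxAl.
Qed.

Lemma hecke_scaleAr (a : C) (f1 f2 : hecke) : a *: (f1 * f2) = f1 * (a *: f2).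
Proof.
apply: val_inj; apply/ffunP => g /=; rewrite !ffunE scalerA mulrC -scalerA.
rewrite scaler_sumr; congr (_ *: _).
by apply: eq_bigr => h _; rewrite ffunE scalemxAr.
Qed.

Definition hecke_at (x : gT) : set hecke :=
  [set f : hecke | forall g, g \notin (J :* x * J)%g -> f g = 0].

End Hecke.

Arguments hecke_at {C gT J d} lam x.

Definition algebra_iso (C : numFieldType) (gT rT : finGroupType) (J : {group gT})
    (I : {group rT}) d m (lam : mx_representation C J d)
    (mu : mx_representation C I m) (phi : hecke lam -> hecke mu) : Prop :=
  [/\ linear phi, GRing.monoid_morphism phi & bijective phi].

(* Main.v *)
(* Since Ker (Kt -> Gk) = Gamma(1)~ acts irreducibly through sigma, the map
   f |-> (g |-> f (p g) (x) sigma^vee(g)) is an isomorphism of Hecke algebras: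
   an element F of the target, multiplied by 1 (x) sigma^vee(g)^-1, commutes
   with sigma^vee on the kernel, so by Schur's lemma it comes from Gk. *)
Require Import Defs.
From HB Require Import structures.
From mathcomp Require Import all_boot all_order all_algebra all_fingroup all_field.
From mathcomp Require Import mxrepresentation character.
From mathcomp Require Import boolp classical_sets reals.
From mathcomp Require Import complex mxtens.

Set Implicit Arguments.
Unset Strict Implicit.
Unset Printing Implicit Defensive.

Import Order.TTheory GRing.Theory Num.Theory GroupScope.

Local Open Scope classical_set_scope.
Local Open Scope ring_scope.

(** * Kronecker products, their blocks, and Schur's lemma on one tensor factor *)

Section TensorProducts.
Variable F : fieldType.

(** [tprod] and [trow] recurse on the first factor; splitting off its index 0 matches their [col_mx]
    and [row_mx]. *)
Lemma mxtens_index_lift m n (i : 'I_m) (j : 'I_n) :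
  mxtens_index (lift ord0 i, j) = rshift n (mxtens_index (i, j)) :> 'I_(m.+1 * n).
Proof. by apply: val_inj; rewrite /= mulSn addnA. Qed.

Lemma mxtens_index0 m n (j : 'I_n) :
  mxtens_index (ord0 : 'I_m.+1, j) = lshift (m * n) j :> 'I_(m.+1 * n).
Proof. exact: val_inj. Qed.

Lemma trow_index n1 (A : 'rV[F]_n1) m2 n2 (B : 'M[F]_(m2, n2)) i j k :
  trow A B i (mxtens_index (j, k)) = A 0 j * B i k.
Proof.
elim: n1 A j => [|n1 IH] A j; first by case: j.
case: (unliftP ord0 j) => [j' ->|->] /=.
  rewrite mxtens_index_lift row_mxEr IH !mxE; congr (A _ _ * _).
  exact: val_inj.
rewrite mxtens_index0 row_mxEl !mxE; congr (A _ _ * _).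
exact: val_inj.
Qed.

(** Product representations are written with [tprod], whereas the multiplication and transposition
    rules used below are those of [*t]. *)
Lemma tprod_tensmx m1 n1 (A : 'M[F]_(m1, n1)) m2 n2 (B : 'M[F]_(m2, n2)) :
  tprod A B = A *t B.
Proof.
apply/matrixP => i j.
case: (mxtens_indexP i) => i1 i2; case: (mxtens_indexP j) => j1 j2 {i j}.
rewrite tensmxE; elim: m1 A i1 => [|m1 IH] A i1; first by case: i1.
case: (unliftP ord0 i1) => [i1' ->|->] /=.
  rewrite mxtens_index_lift col_mxEd IH !mxE; congr (A _ _ * _).
  exact: val_inj.
rewrite mxtens_index0 col_mxEu trow_index !mxE; congr (A _ _ * _).
exact: val_inj.
Qed.

Lemma tensmx11 m n : (1%:M : 'M[F]_m) *t (1%:M : 'M[F]_n) = 1%:M.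
Proof. by rewrite -tprod_tensmx tprod1. Qed.

Lemma sum_mxtens_index m n (f : 'I_(m * n) -> F) :
  \sum_k f k = \sum_i \sum_j f (mxtens_index (i, j)).
Proof.
rewrite pair_big /= (reindex (@mxtens_index m n)) /=.
  by apply: eq_bigr => -[].
exists (@mxtens_unindex m n) => ? _; [exact: mxtens_indexK|exact: mxtens_unindexK].
Qed.

(** Reads [M] as an [m] by [m] matrix with entries in the [n] by [n] matrices. *)
Definition mxblk m n (M : 'M[F]_(m * n)) (i j : 'I_m) : 'M[F]_n :=
  \matrix_(k, l) M (mxtens_index (i, k)) (mxtens_index (j, l)).

Lemma mxblk_mul1t m n (M : 'M[F]_(m * n)) (B : 'M[F]_n) i j :
  mxblk (M *m (1%:M *t B)) i j = mxblk M i j *m B.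
Proof.
apply/matrixP => k l; rewrite !mxE sum_mxtens_index (bigD1 j) //=.
rewrite [X in _ + X]big1 ?addr0 => [|j' /negbTE nj].
  by apply: eq_bigr => l' _; rewrite tensmxE !mxE eqxx mul1r.
by rewrite big1 // => l' _; rewrite tensmxE !mxE nj mul0r mulr0.
Qed.

Lemma mxblk_1t_mul m n (M : 'M[F]_(m * n)) (B : 'M[F]_n) i j :
  mxblk ((1%:M *t B) *m M) i j = B *m mxblk M i j.
Proof.
apply/matrixP => k l; rewrite !mxE sum_mxtens_index (bigD1 i) //=.
rewrite [X in _ + X]big1 ?addr0 => [|i' /negbTE ni].
  by apply: eq_bigr => l' _; rewrite tensmxE !mxE eqxx mul1r.
by rewrite big1 // => l' _; rewrite tensmxE !mxE eq_sym ni !mul0r.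
Qed.

(** Cancelling the invertible [B] leaves [X *t 1 = Y *t 1], and a diagonal entry of the factor 1,
    available since [n > 0], recovers [X] and [Y]. *)
Lemma tensmx_unit_inj m n (B B' : 'M[F]_n) (X Y : 'M[F]_m) :
  (0 < n)%N -> B *m B' = 1%:M -> X *t B = Y *t B -> X = Y.
Proof.
move=> n_gt0 BB' eXY; have {}eXY: X *t (1%:M : 'M_n) = Y *t 1%:M.
  by rewrite -BB' -[X]mulmx1 -[Y]mulmx1 -!tensmx_mul eXY.
apply/matrixP => i j; pose k := Ordinal n_gt0.
have /matrixP/(_ (mxtens_index (i, k)) (mxtens_index (j, k))) := eXY.
by rewrite !tensmxE !mxE eqxx !mulr1.
Qed.

End TensorProducts.

(** Each block of [M] commutes with all [(rho k)^T], so its transpose centralizes [rho] and is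
    scalar by Schur's lemma; these scalars are the entries of [X]. *)
Lemma cent_tensmx (F : closedFieldType) (gT : finGroupType) (N : {group gT})
    d n (rho : mx_representation F N n) (M : 'M[F]_(d * n)) :
  mx_irreducible rho ->
  (forall k, k \in N -> M *m (1%:M *t (rho k)^T) = (1%:M *t (rho k)^T) *m M) ->
  exists X : 'M[F]_d, M = X *t 1%:M.
Proof.
move=> irr cM; have absirr := group_closure_closed_field irr.
have scal i j : is_scalar_mx (mxblk M i j)^T.
  apply: (mx_abs_irr_cent_scalar absirr); apply/centgmxP => k Nk.
  apply: trmx_inj; rewrite !trmx_mul trmxK.
  by rewrite -mxblk_1t_mul -mxblk_mul1t cM.
have n_gt0 : (0 < n)%N by case/mx_irrP: irr.
pose k := Ordinal n_gt0; exists (\matrix_(i, j) mxblk M i j k k).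
apply/matrixP => r s; case: (mxtens_indexP r) => i a; case: (mxtens_indexP s) => j b.
rewrite tensmxE mxE; have /is_scalar_mxP[c Ec] := scal i j.
have -> : M (mxtens_index (i, a)) (mxtens_index (j, b)) = mxblk M i j a b.
  by rewrite mxE.
by rewrite -[mxblk M i j]trmxK Ec tr_scalar_mx !mxE eqxx mulr1n mulr_natr.
Qed.

(** * The Hecke algebra isomorphism for inflation along a surjection, twisted by [sigma] *)

Section Inflation.
Variables (C : numClosedFieldType) (gT rT : finGroupType).
Variable p : {morphism [set: gT]%G >-> rT}.
Hypothesis p_surj : forall y, exists g, p g = y.
Variables (J : {group gT}) (I : {group rT}) (d m : nat).
Hypothesis sJI : J \subset p @*^-1 I.
Hypothesis sIJ : p @*^-1 I \subset J.
Variables (pi : mx_representation C I d) (sigma : mx_representation C [set: gT]%G m).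
Variable N : {group gT}.
Hypothesis NE : N = ('ker p)%G.
Hypothesis irrN : mx_irreducible (subg_repr sigma (finset.subsetT N)).

Let pi_sigma := infl_tensor sJI pi sigma.
Let ds := dual_mx sigma.

Let memJ g : (g \in J) = (p g \in I).
Proof.
apply/idP/idP => [/(fintype.subsetP sJI)|Ig]; first by rewrite !inE.
by apply: (fintype.subsetP sIJ); rewrite !inE.
Qed.

Let memN g : (g \in N) = (p g == 1%g).
Proof. by rewrite NE !inE. Qed.

Let pM g h : p (g * h)%g = (p g * p h)%g.
Proof. by rewrite morphM ?inE. Qed.

Let pV g : p g^-1%g = (p g)^-1%g.
Proof. by rewrite morphV ?inE. Qed.

Let dsM g h : ds (g * h)%g = ds g *m ds h.
Proof. by rewrite /ds dualM ?inE. Qed.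

Let dsV g : ds g *m ds g^-1%g = 1%:M.
Proof. by rewrite -dsM mulgV /ds dual1. Qed.

Let dsVl g : ds g^-1%g *m ds g = 1%:M.
Proof. by rewrite -dsM mulVg /ds dual1. Qed.

Let m_gt0 : (0 < m)%N.
Proof. by case/mx_irrP: irrN. Qed.

Let tensI (X Y : 'M[C]_d) g : X *t ds g = Y *t ds g -> X = Y.
Proof. exact: tensmx_unit_inj m_gt0 (dsV g). Qed.

Let dual_tens k : dual_mx pi_sigma k = dual_mx pi (p k) *t ds k.
Proof. by rewrite /dual_mx infl_tensorE tprod_tensmx trmx_tens pV. Qed.

Lemma twist_subproof (f : hecke pi) :
  [ffun g => f (p g) *t ds g] \in hecke_pred pi_sigma.
Proof.
apply/heckeP => k1 k2 g J1 J2; rewrite !ffunE !dual_tens !dsM !pM.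
have /heckeP hf := hecke_valP f.
by rewrite hf -?memJ // !tensmx_mul.
Qed.

Definition twist (f : hecke pi) : hecke pi_sigma := Hecke (twist_subproof f).

(** Every fibre of [p] is a coset of its kernel [N]. *)
Let sum_fiber (V : nmodType) (f : rT -> V) :
  \sum_h f (p h) = (\sum_y f y) *+ #|N|.
Proof.
rewrite (partition_big p predT) //= -sumrMnl; apply: eq_bigr => y _.
have [g <-] := p_surj y.
rewrite (eq_bigr (fun=> f (p g))) => [|h /eqP -> //].
rewrite sumr_const -(card_lcoset N g); congr (_ *+ _).
apply: eq_card => h; rewrite mem_lcoset memN pM pV.
by rewrite -eq_mulVg1 eq_sym.
Qed.

(** [J] is the full preimage of [I]; this compares the normalizations of the two convolutions. *)
Let cardJ : #|J|%:R = #|I|%:R * #|N|%:R :> C.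
Proof.
have card1 (hT : finGroupType) (H : {group hT}) : #|H|%:R = \sum_h (h \in H)%:R :> C.
  by rewrite -sum1_card natr_sum big_mkcond; apply: eq_bigr => h _; case: ifP.
rewrite (card1 _ J) (card1 _ I); under eq_bigr do rewrite memJ.
by rewrite (sum_fiber (fun y => (y \in I)%:R)) mulr_natr.
Qed.

Let twist_linear : linear twist.
Proof.
move=> a f1 f2; apply/val_inj/ffunP => g; rewrite /= !ffunE /=.
by apply/matrixP => i j; rewrite !mxE mulrDl mulrA.
Qed.

(** In the convolution, [ds h] and [ds (h^-1 * g)] multiply to [ds g], whatever [h] is. The
    remaining sum depends on [p h] only, and the factor [#|N|] from the fibres cancels against
    [cardJ]. *)
Let twist_morphism : GRing.monoid_morphism twist.
Proof.
split=> [|f1 f2]; apply/val_inj/ffunP => g; rewrite /= !ffunE.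
  by rewrite memJ; case: ifP => _; rewrite ?dual_tens // tens0mx.
rewrite cardJ invfM -scalerA.
under [in RHS]eq_bigr => h _.
  rewrite !ffunE tensmx_mul -dsM mulKVg pM pV.
  over.
rewrite (sum_fiber (fun y => (f1 y *m f2 (y^-1 * p g)%g) *t ds g)).
rewrite -scaler_nat !scalerA ?mulrA divfK ?pnatr_eq0 -?lt0n ?cardG_gt0 //.
apply/matrixP => i j; rewrite !mxE !summxE -mulrA mulr_suml.
congr (_ * _); apply: eq_bigr => h _.
by rewrite !mxE.
Qed.

Let twist_inj : injective twist.
Proof.
move=> f1 f2 /(congr1 val)/ffunP e; apply/val_inj/ffunP => y /=.
by have [g <-] := p_surj y; apply: (@tensI _ _ g); have := e g; rewrite !ffunE.
Qed.

(* F(g) (1 (x) ds(g)^-1) depends only on p(g), because ds(g)^-1 cancels the right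
   action of N; moving N across g then shows that it commutes with 1 (x) ds(N),
   so that Schur's lemma applies. *)
Let hecke_twisted (F : hecke pi_sigma) y :
  exists X : 'M[C]_d, forall g, p g = y -> F g = X *t ds g.
Proof.
have /heckeP hF := hecke_valP F.
have dN k : k \in N -> dual_mx pi_sigma k = 1%:M *t ds k.
  by rewrite memN => /eqP pk; rewrite dual_tens pk dual1.
have NJ k : k \in N -> k \in J by rewrite memN memJ => /eqP ->.
have Fl k g : k \in N -> F (k * g)%g = (1%:M *t ds k) *m F g.
  move=> Nk; have := hF k 1%g g (NJ k Nk) (group1 J).
  by rewrite mulg1 dual1 mulmx1 dN.
have Fr k g : k \in N -> F (g * k)%g = F g *m (1%:M *t ds k).
  move=> Nk; have := hF 1%g k g (group1 J) (NJ k Nk).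
  by rewrite mul1g dual1 mul1mx dN.
have [g0 pg0] := p_surj y.
have [k Nk|X EX] := cent_tensmx (M := F g0 *m (1%:M *t ds g0^-1%g)) irrN.
  have Nkg : (k^-1 ^ g0)%g \in N
    by move: Nk; rewrite !memN !(pM, pV) => /eqP ->; rewrite invg1 mul1g mulVg.
  (* The dual inverts its argument, so the transpose that Schur's lemma speaks of is [ds] at
     [k^-1]. *)
  have -> : (subg_repr sigma (finset.subsetT N) k)^T = ds k^-1%g by rewrite /ds /dual_mx invgK.
  rewrite mulmxA -Fl ?groupV // -mulmxA tensmx_mul mulmx1 -dsM.
  have -> : (k^-1 * g0 = g0 * k^-1 ^ g0)%g by rewrite conjgE !mulgA mulgV mul1g.
  by rewrite Fr // -mulmxA tensmx_mul mulmx1 -dsM conjgE -!mulgA mulgV mulg1.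
exists X => g pg; have Nk : (g0^-1 * g)%g \in N.
  by rewrite memN pM pV pg pg0 mulVg.
(* Write [g] as [g0] times an element of [N], and insert [ds g0^-1 *m ds g0] after [F g0] to make
   [X *t 1] appear. *)
rewrite -[g](mulKVg g0) Fr // -{1}[F g0]mulmx1 -tensmx11 -(dsVl g0).
rewrite -{1}[1%:M](mulmx1 (1%:M : 'M_d)) -tensmx_mul mulmxA EX.
by rewrite !tensmx_mul !mulmx1 mul1mx -dsM.
Qed.

(** The matrices [X] attached to the points [y] form [f]; its equivariance is that of [F] after
    cancelling the factor [ds]. *)
Let twist_surj (F : hecke pi_sigma) : exists f, twist f = F.
Proof.
have [f Ef] := choice (hecke_twisted F).
have fP : [ffun y => f y] \in hecke_pred pi.
  apply/heckeP => i1 i2 y; have [[k1 <-] [k2 <-]] := (p_surj i1, p_surj i2).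
  have [g <-] := p_surj y; rewrite -!memJ => J1 J2; rewrite !ffunE.
  apply: (@tensI _ _ (k1 * g * k2)%g); have /heckeP hF := hecke_valP F.
  have := hF k1 k2 g J1 J2; rewrite (Ef _ g erefl) (Ef _ (k1 * g * k2)%g erefl).
  by rewrite !pM !dual_tens !tensmx_mul !dsM.
by exists (Hecke fP); apply/val_inj/ffunP => g; rewrite /= !ffunE (Ef _ g erefl).
Qed.

(** Double cosets of [J] are preimages of double cosets of [I], so supports correspond for every
    choice of the lift [yt]. *)
Let mem_dcoset yt g : (g \in J :* yt * J)%g = (p g \in I :* p yt * I)%g.
Proof.
apply/imset2P/imset2P => [[h j /rcosetP[k Jk ->] Jj ->]|].
  exists (p k * p yt)%g (p j); rewrite -?memJ ?pM //.
  by apply/rcosetP; exists (p k); rewrite -?memJ.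
case=> h j /rcosetP[k Ik ->] Ij.
have [[k' Ek] [j' Ej]] := (p_surj k, p_surj j); subst k j => pg.
(* [g] agrees with [k' * yt * j'] only modulo [N], so the right factor is taken to be
   [(k' * yt)^-1 * g], whose image is that of [j']. *)
exists (k' * yt)%g ((k' * yt)^-1 * g)%g; last by rewrite mulKVg.
  by apply/rcosetP; exists k'; rewrite ?memJ.
by rewrite memJ pM pV !pM pg mulKg.
Qed.

Lemma hecke_inflation_iso :
  exists phi : hecke pi -> hecke pi_sigma, algebra_iso phi /\
    forall y yt, p yt = y -> phi @` hecke_at pi y = hecke_at pi_sigma yt.
Proof.
have [psi psiK] := choice twist_surj.
exists twist; split.
  split=> //; exists psi => // f; apply: twist_inj; exact: psiK.
move=> y yt <-; apply/seteqP; split=> [_ [f fy <-] g|F Fy].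
  by rewrite mem_dcoset => /fy /= fg0; rewrite ffunE fg0 tens0mx.
have [f Ef] := twist_surj F; exists f => // z; have [g <-] := p_surj z.
rewrite -mem_dcoset => /Fy; rewrite -Ef /= ffunE => e0.
by apply: (@tensI _ _ g); rewrite e0 tens0mx.
Qed.

End Inflation.

(** * Kernel and preimages for the projection of the finite quotient of the cover *)

Section PreimagesInQuotient.
Variables (G Gt : groupType) (Gk Kt : finGroupType) (pr : Gt -> G) (q : Gt -> Kt).
Variables (red : G -> Gk) (p : {morphism [set: Kt]%G >-> Gk}) (K N : set G).
Hypothesis pr_surj : forall g, exists h, pr h = g.
Hypothesis red_quotient : is_quotient K N red.
Hypothesis q_surj : forall y, exists2 g, K (pr g) & q g = y.
Hypothesis pq : forall g, K (pr g) -> p (q g) = red (pr g).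

Lemma quotient_morphism_surj y : exists g, p g = y.
Proof.
have [_ redS _ _] := red_quotient; have [a Ka <-] := redS y.
by have [h Eh] := pr_surj a; exists (q h); rewrite pq Eh.
Qed.

Lemma mem_img (S : set G) g : S (pr g) -> q g \in img q (pr @^-1` S).
Proof. by move=> Sg; apply: mem_gen; rewrite inE; apply/asboolP; exists g. Qed.

Lemma ker_img : img q (pr @^-1` N) = ('ker p)%G.
Proof.
have [_ _ sNK kerN] := red_quotient.
apply/group_inj/setP/subset_eqP/andP; split.
  rewrite gen_subG; apply/fintype.subsetP => y; rewrite inE => /asboolP[g Ng <-].
  by rewrite !inE pq; [apply/eqP/kerN => //|]; apply: sNK.
apply/fintype.subsetP => y; have [g Kg <-] := q_surj y.
by rewrite !inE pq //= => /eqP/(kerN _ Kg)/mem_img.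
Qed.

(** The image of the preimage of [H] contains [ker p], because [N] lies in [H]; it is therefore the
    full preimage of its own image under [p], which contains [img red H]. *)
Lemma morphpre_img_sub (H : set G) :
  N `<=` H -> H `<=` K -> p @*^-1 (img red H) \subset img q (pr @^-1` H).
Proof.
move=> sNH sHK; set J := img q _.
have sIJ : img red H \subset p @* J.
  rewrite gen_subG; apply/fintype.subsetP => y; rewrite inE => /asboolP[h Hh <-].
  have [g Eg] := pr_surj h; have Hg : H (pr g) by rewrite Eg.
  by rewrite -Eg -pq ?mem_morphim ?inE ?mem_img //; exact: sHK.
have skJ : img q (pr @^-1` N) \subset J.
  rewrite gen_subG; apply/fintype.subsetP => y; rewrite inE => /asboolP[g Ng <-].
  exact/mem_img/sNH.
rewrite ker_img in skJ.
by rewrite -(morphimGK skJ (finset.subsetT J)) morphpreS.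
Qed.

End PreimagesInQuotient.

Theorem theorem6p7
  (R : realType)
  (D : dyadic_field)
  (Phi : root_system R)
  (A : admissible_repr Phi)
  (* the group G over D, and the group over the residue field *)
  (G : groupType) (x : 'rV[R]_(rank Phi) -> D -> G)
  (hG : chevalley_group A x)
  (Gk : finGroupType) (xk : 'rV[R]_(rank Phi) -> kappa D -> Gk)
  (hGk : chevalley_group A xk)
  (red : G -> Gk) (hred : is_reduction x xk red)
  (* the double cover of G *)
  (Gt : groupType) (pr : Gt -> G) (eps : Gt)
  (xt : 'rV[R]_(rank Phi) -> D -> Gt)
  (hGt : double_cover A x pr eps xt)
  (* the quotient Kt of the cover of K by the split Gamma(2e), and its
     projection to Gk *)
  (Kt : finGroupType) (q : Gt -> Kt)
  (hq : is_quotient (pr @^-1` Kgrp x) (split_Gamma2e xt) q)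
  (p : {morphism [set: Kt]%G >-> Gk})
  (hp : forall g, Kgrp x (pr g) -> p (q g) = red (pr g))
  (* a pseudo-spherical representation tau *)
  (n : nat)
  (tau : mx_representation R[i] (img q (pr @^-1` T0grp x)) n)
  (htau : pseudo_spherical q eps (TRgrp xt) tau)
  (* the extension sigma to Kt of the irreducible parahorically induced
     representation of the image of the cover of Gamma(1) *)
  (m : nat) (sigma : mx_representation R[i] [set: Kt]%G m) :
  let Gam1 := img q (pr @^-1` Gamma x 1%N) in
  let sigma1 := subg_repr sigma (finset.subsetT Gam1) in
  is_parahoric_ind (img q (Upos xt 1%N)) (img q (Uneg xt 1%N))
                   (img q (pr @^-1` Tgrp x 1%N)) tau sigma1 ->
  mx_irreducible sigma1 ->
  forall (H : set G) (hH : is_subgroup H)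
         (hGamH : Gamma x 1%N `<=` H) (hHK : H `<=` Kgrp x)
         (d : nat) (pi : mx_representation R[i] (img red H) d),
  let pi_sigma := infl_tensor (img_sub hp hHK) pi sigma in
  exists phi : hecke pi -> hecke pi_sigma,
    algebra_iso phi /\
    forall (y : Gk) (yt : Kt), p yt = y ->
      phi @` (hecke_at pi y) = hecke_at pi_sigma yt.
Proof.
move=> Gam1 sigma1 _ irr1 H _ sGamH sHK d pi.
have [hred1 _] := hred; have [_ qS _ _] := hq.
(* The kernel [N] is [Gam1], on which [sigma] is irreducible. What remains is that [p] is onto, that
   the subgroup is a full preimage, and that [Gam1] is the kernel. *)
apply: hecke_inflation_iso irr1.
- exact: quotient_morphism_surj (cov_surj hGt) hred1 hp.
- exact (morphpre_img_sub (cov_surj hGt) hred1 qS hp sGamH sHK).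
- exact: ker_img hred1 qS hp.
Qed.
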